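(* Let $d\ge 2$ and let $X_1,\ldots,X_d$ be independent and identically distributed random variables with distribution function $F$ and density function $f$. Then the order statistics $X_{(1)},X_{(2)},\ldots,X_{(d)}$ are conditionally increasing in sequence (CIS).
   Context: The $i$-th order statistic $X_{(i)}$ is the $i$-th smallest of $X_1,\ldots,X_d$. Random variables $Y_1,\ldots,Y_d$ are conditionally increasing in sequence (CIS) if, for every $2\le i\le d$ and all $y\in\overline{\mathbb{R}}=[-\infty,\infty]$, $\mathbb{P}[Y_i>y\mid Y_1=y_1,\ldots,Y_{i-1}=y_{i-1}]$ is nondecreasing in $y_1,\ldots,y_{i-1}$ (componentwise order). Conditional probabilities are computed from joint densities, at points $(y_1,\ldots,y_{i-1})$ where the joint density of the conditioning vector is positive, and monotonicity refers to such points. For $1\le i\le d$ the joint density of $(X_{(1)},\ldots,X_{(i)})$ at $(x_1,\ldots,x_i)$ is $\frac{d!}{(d-i)!}[1-F(x_i)]^{d-i}\prod_{k=1}^{i}f(x_k)$ if $x_1\le\cdots\le x_i$, and $0$ otherwise. *)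

(* Defs.v *)
From HB Require Import structures.
From mathcomp Require Import all_boot all_order all_algebra.
From mathcomp Require Import all_classical all_reals all_analysis.
From mathcomp Require Import measurable_realfun.
Import Order.TTheory GRing.Theory Num.Theory.
Import numFieldNormedType.Exports.

Set Implicit Arguments.
Unset Strict Implicit.
Unset Printing Implicit Defensive.

Local Open Scope classical_set_scope.
Local Open Scope ring_scope.

(* Lebesgue measure on R^n, as the n-fold product of Lebesgue measures on R,
   transported along R * R^n -> R^(n.+1). *)
Fixpoint lebesgue_tuple (R : realType) (n : nat) :
    set (n.-tuple (measurableTypeR R)) -> \bar R :=
  match n with
  | 0 => dirac [tuple]
  | n'.+1 => pushforward
      (product_measure1 (@lebesgue_measure R) (@lebesgue_tuple R n'))
      (fun p : measurableTypeR R * n'.-tuple (measurableTypeR R) =>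
         [tuple of p.1 :: p.2])
  end.

Definition is_density (R : realType) (d : measure_display)
    (E : measurableType d) (lambda mu : set E -> \bar R) (g : E -> R) : Prop :=
  [/\ measurable_fun setT g,
      forall x, 0 <= g x
    & forall A, measurable A -> mu A = (\int[lambda]_(x in A) (g x)%:E)%E].

Section random_vectors.
Context (d : measure_display) (T : measurableType d) (R : realType)
  (P : probability T R) (n : nat).
Implicit Types X Y : 'I_n -> {RV P >-> R}.

Definition mutually_independent X : Prop :=
  forall (J : {set 'I_n}) (A : 'I_n -> set R),
    (forall j, measurable (A j)) ->
    P (\bigcap_(j in [set` J]) (X j @^-1` A j)) =
    (\prod_(j in J) P (X j @^-1` A j))%E.

Definition identically_distributed X : Prop :=
  forall (i j : 'I_n) (A : set R), measurable A ->
    distribution P (X i) A = distribution P (X j) A.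

(* 0-based: order_stat X i is the (i+1)-th smallest value. *)
Definition order_stat X (i : 'I_n) (t : T) : R :=
  nth 0 (sort <=%O [seq X j t | j <- enum 'I_n]) i.

Lemma order_stat_le X i t y :
  (order_stat X i t <= y) = (i < count (<= y) [seq X j t | j <- enum 'I_n])%N.
Proof.
rewrite /order_stat; set s := [seq _ | _ <- _]; set u := sort _ s.
have us : sorted <=%O u by exact: sort_le_sorted.
have szu : size u = n by rewrite size_sort size_map size_enum_ord.
have /permP/(_ (<= y)) <- : perm_eq u s by rewrite perm_sort.
have [iu|ui] := ltnP i (count (<= y) u); first exact: nth_count_le.
by apply/negbTE; rewrite -ltNge; apply: nth_count_gt => //; rewrite ui szu /=.
Qed.

Lemma measurable_order_stat X i : measurable_fun setT (order_stat X i).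
Proof.
move=> mD; apply: (measurability _ (RGenOInfty.measurableE R)) => //.
move=> _ [_ [y ->] <-]; rewrite setTI.
have -> : order_stat X i @^-1` `]y, +oo[ =
    \bigcup_(B in [set B : {set 'I_n} | (#|B| <= i)%N])
      \bigcap_(j in [set: 'I_n]) [set t | (X j t <= y) = (j \in B)].
  have cE t : count (<= y) [seq X j t | j <- enum 'I_n] =
      #|[set j | X j t <= y]%SET|.
    rewrite -sum1_card -sum1_count big_map big_enum_cond /=.
    by apply: eq_bigl => j; rewrite inE.
  apply/seteqP; split=> t /=.
    rewrite in_itv/= andbT ltNge order_stat_le cE -leqNgt => ci.
    by exists [set j | X j t <= y]%SET => //= j _; rewrite inE.
  move=> [B /= Bi tB]; rewrite in_itv/= andbT ltNge order_stat_le cE -leqNgt.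
  suff -> : [set j | X j t <= y]%SET = B by [].
  by apply/setP => j; rewrite inE; exact: tB.
apply: fin_bigcup_measurable => // B _.
apply: fin_bigcap_measurable => // j _.
have mXy : measurable [set t | X j t <= y].
  rewrite [X in measurable X](_ : _ = X j @^-1` `]-oo, y]); last first.
    by apply/seteqP; split=> t /=; rewrite in_itv.
  exact: measurable_funPTI.
case: (j \in B) => //.
rewrite [X in measurable X](_ : _ = ~` [set t | X j t <= y]).
  exact: measurableC.
by apply/seteqP; split=> t /=; case: (X j t <= y) => // /(_ erefl).
Qed.

HB.instance Definition _ X i :=
  isMeasurableFun.Build _ _ _ _ (order_stat X i) (measurable_order_stat X i).

Definition initial_vector Y (k : nat) (kn : (k <= n)%N) (t : T) :
    k.-tuple (measurableTypeR R) :=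
  [tuple Y (widen_ord kn j) t | j < k].

(* g k plays the role of the joint density of the first k variables. *)
Definition joint_densities Y (g : forall k, k.-tuple R -> R) : Prop :=
  forall (k : nat) (kn : (k <= n)%N), (0 < k)%N ->
    is_density (@lebesgue_tuple R k) (pushforward P (initial_vector Y kn)) (g k).

(* P[Y_{k+1} > y | Y_1 = x_1, ..., Y_k = x_k] computed from the joint densities;
   meaningful only where 0 < g k x. *)
Definition cond_gt (g : forall k, k.-tuple R -> R) (k : nat) (x : k.-tuple R)
    (y : \bar R) : \bar R :=
  ((\int[lebesgue_measure]_(u in [set u : R | y < u%:E])
      (g k.+1 [tuple of rcons x u])%:E) / (g k x)%:E)%E.

(* Densities are unique only almost everywhere, whereas monotonicity is required
   at every point of positive density: the versions g are part of the notion. *)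
Definition CIS Y (g : forall k, k.-tuple R -> R) : Prop :=
  joint_densities Y g /\
  forall k : nat, (0 < k < n)%N ->
    forall (y : \bar R) (x x' : k.-tuple R),
      0 < g k x -> 0 < g k x' ->
      (forall j : 'I_k, tnth x j <= tnth x' j) ->
      (cond_gt g x y <= cond_gt g x' y)%E.

End random_vectors.

(* The density of (X_(1), ..., X_(k)) for 1 <= k <= n; the value at k = 0 is
   irrelevant, and for k > 0 the default 0 of last is not used. *)
Definition order_stat_density (R : realType) (F f : R -> R) (n k : nat)
    (x : k.-tuple R) : R :=
  if sorted <=%O x then
    n`!%:R / (n - k)`!%:R * (1 - F (last 0 x)) ^+ (n - k) *
    \prod_(j < k) f (tnth x j)
  else 0.

(* Main.v *)
(* The vector (X_(1), ..., X_(d)) is, off the null set of ties, the one permuted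
   vector (X_s(1), ..., X_s(d)) that is sorted; all the permuted vectors have
   the density f(x_1) ... f(x_d), so summing over the d! permutations gives the
   joint density of the order statistics. The density of the first k of them
   follows by integrating out the last coordinate repeatedly. This uses
     int_(u > z) (1 - F u)^m f u du = (1 - F z)^(m+1) / (m+1),
   proved by Tonelli since F is only absolutely continuous. By the same
   identity, P[X_(k+1) > y | X_(1) = x_1, ..., X_(k) = x_k] is
   ((1 - F (max x_k y)) / (1 - F x_k))^(d-k), which is nondecreasing in x_k. *)
Require Import Defs.
From HB Require Import structures.
From mathcomp Require Import all_boot all_order all_algebra all_fingroup.
From mathcomp Require Import all_classical all_reals all_analysis.
From mathcomp Require Import measurable_realfun ring.
Import Order.TTheory GRing.Theory Num.Theory.
Import numFieldNormedType.Exports.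

Set Implicit Arguments.
Unset Strict Implicit.
Unset Printing Implicit Defensive.

Local Open Scope classical_set_scope.
Local Open Scope ring_scope.

(** * Lebesgue measure on tuples *)

(** Packs a bare set function into the bundled type, so that an induction can carry a sigma-finite
    measure as a witness before any instance is declared. *)
Lemma ex_sigma_finite_measure d (T : measurableType d) (R : realType)
    (mu : set T -> \bar R) :
  mu set0 = 0%E -> (forall A, 0 <= mu A)%E -> semi_sigma_additive mu ->
  sigma_finite setT mu ->
  exists m : {sigma_finite_measure set T -> \bar R},
    m = mu :> (set T -> \bar R).
Proof.
move=> mu0 mu_ge0 mu_sadd mu_sf.
pose Mm := isMeasure.Build _ _ _ mu mu0 mu_ge0 mu_sadd.
pose M : {measure set T -> \bar R} := HB.pack mu Mm.
pose Ms := Measure_isSigmaFinite.Build _ _ _ M mu_sf.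
by exists (HB.pack_for {sigma_finite_measure set T -> \bar R} mu Mm Ms).
Qed.

Section lebesgue_tuple_measure.
Context (R : realType).
Local Notation rT := (measurableTypeR R).

Lemma measurable_cons_pair n :
  measurable_fun [set: rT * n.-tuple rT]
    (fun p : rT * n.-tuple rT => [tuple of p.1 :: p.2]).
Proof. exact: measurable_cons. Qed.

Lemma measurable_uncons n :
  measurable_fun [set: n.+1.-tuple rT]
    (fun t : n.+1.-tuple rT => (thead t, [tuple of behead t])).
Proof.
apply: measurable_fun_pair; last exact: measurable_behead.
exact: measurable_tnth.
Qed.

(** Being a measure and being sigma-finite are proved in one induction: the product at step [n.+1]
    is handled as a measure because its second factor is already known to be a sigma-finite
    measure. *)
Lemma lebesgue_tuple_sigma_finite_measure n :
  exists m : {sigma_finite_measure set (n.-tuple rT) -> \bar R},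
    m = @lebesgue_tuple R n :> (set (n.-tuple rT) -> \bar R).
Proof.
elim: n => [|n [m mE]].
  by exists (@dirac _ (0.-tuple rT) [tuple] R).
pose phi := fun p : rT * n.-tuple rT => [tuple of p.1 :: p.2].
have mphi : measurable_fun setT phi by exact: measurable_cons_pair.
pose pm : {measure set (rT * n.-tuple rT)%type -> \bar R} :=
  (@lebesgue_measure R \x m)%E.
pose mu := pushforward pm phi.
have mu_sf : sigma_finite setT mu.
  have /sigma_finiteP[F [FT ndF Foo]] := sigma_finiteT (@lebesgue_measure R).
  have /sigma_finiteP[G [GT ndG Goo]] := sigma_finiteT m.
  exists (fun k => (fun t : n.+1.-tuple rT =>
    (thead t, [tuple of behead t])) @^-1` (F k `*` G k)).
    apply/esym; rewrite -subTset => t _.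
    have [k _ Fk] : (\bigcup_k F k) (thead t) by rewrite -FT.
    have [l _ Gl] : (\bigcup_k G k) [tuple of behead t] by rewrite -GT.
    (* Both exhausting sequences increase, so the larger index serves for head and tail at once. *)
    exists (maxn k l) => //; split => /=.
    - by move: Fk; exact/subsetPset/ndF/leq_maxl.
    - by move: Gl; exact/subsetPset/ndG/leq_maxr.
  move=> k; have [mF Fk] := Foo k; have [mG Gk] := Goo k; split.
    rewrite -[X in measurable X]setTI.
    by apply: measurable_uncons => //; exact: measurableX.
  rewrite /mu /pushforward -comp_preimage.
  rewrite [X in pm X](_ : _ = F k `*` G k).
    rewrite /pm /= product_measure1E// lte_mul_pinfty// ge0_fin_numE//.
  have tE (x : rT) (t : n.-tuple rT) : [tuple of behead [tuple of x :: t]] = t.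
    exact/val_inj.
  by apply/seteqP; split => -[x t] /=; rewrite theadE tE.
have mu0 : mu set0 = 0%E by apply: measure0.
have mu_ge0 A : (0 <= mu A)%E by apply: measure_ge0.
have mu_sadd : semi_sigma_additive mu by apply: measure_semi_sigma_additive.
have [M ME] := ex_sigma_finite_measure mu0 mu_ge0 mu_sadd mu_sf.
by exists M; rewrite ME /= /mu -mE.
Qed.

Let lebesgue_tuple0 n : @lebesgue_tuple R n set0 = 0%E.
Proof.
by have [m <-] := lebesgue_tuple_sigma_finite_measure n; exact: measure0.
Qed.

Let lebesgue_tuple_ge0 n A : (0 <= @lebesgue_tuple R n A)%E.
Proof.
by have [m <-] := lebesgue_tuple_sigma_finite_measure n; exact: measure_ge0.
Qed.

Let lebesgue_tuple_sigma_additive n :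
  semi_sigma_additive (@lebesgue_tuple R n).
Proof.
have [m <-] := lebesgue_tuple_sigma_finite_measure n.
exact: measure_semi_sigma_additive.
Qed.

HB.instance Definition _ n := isMeasure.Build _ _ _ (@lebesgue_tuple R n)
  (lebesgue_tuple0 n) (@lebesgue_tuple_ge0 n)
  (@lebesgue_tuple_sigma_additive n).

Let lebesgue_tuple_sigma_finite n : sigma_finite setT (@lebesgue_tuple R n).
Proof.
by have [m <-] := lebesgue_tuple_sigma_finite_measure n; exact: sigma_finiteT.
Qed.

HB.instance Definition _ n := Measure_isSigmaFinite.Build _ _ _
  (@lebesgue_tuple R n) (lebesgue_tuple_sigma_finite n).

Lemma integral_lebesgue_tuple0 (phi : 0.-tuple rT -> \bar R) :
  measurable_fun [set: 0.-tuple rT] phi ->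
  (\int[@lebesgue_tuple R 0]_t phi t = phi [tuple])%E.
Proof. by move=> mphi; rewrite integral_dirac ?diracT ?mul1e. Qed.

Lemma integral_lebesgue_tupleS n (phi : n.+1.-tuple rT -> \bar R) :
  measurable_fun [set: n.+1.-tuple rT] phi -> (forall t, 0 <= phi t)%E ->
  (\int[@lebesgue_tuple R n.+1]_t phi t =
   \int[lebesgue_measure]_x \int[@lebesgue_tuple R n]_t
      phi [tuple of x :: t])%E.
Proof.
move=> mphi phi0.
rewrite [LHS](ge0_integral_pushforward (@measurable_cons_pair n)
  (@lebesgue_measure R \x @lebesgue_tuple R n)%E)//.
rewrite preimage_setT fubini_tonelli1//.
  by apply: measurableT_comp => //; exact: measurable_cons_pair.
by move=> p; exact: phi0.
Qed.

(* Otherwise unification unfolds the iterated product. *)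
#[local] Opaque lebesgue_tuple.

(** Tonelli puts the first coordinate innermost, as needed to measure the set of ties with the other
    coordinates fixed. *)
Lemma integral_lebesgue_tupleS_exchange n (phi : n.+1.-tuple rT -> \bar R) :
  measurable_fun [set: n.+1.-tuple rT] phi -> (forall t, 0 <= phi t)%E ->
  (\int[@lebesgue_tuple R n.+1]_t phi t =
   \int[@lebesgue_tuple R n]_t \int[lebesgue_measure]_x
      phi [tuple of x :: t])%E.
Proof.
move=> mphi phi0; rewrite integral_lebesgue_tupleS//.
rewrite (@fubini_tonelli _ _ _ _ _ _ _
  (fun p : rT * n.-tuple rT => phi [tuple of p.1 :: p.2]))//.
by apply: measurableT_comp => //; exact: measurable_cons_pair.
Qed.

Lemma measurable_rcons_pair n :
  measurable_fun [set: n.-tuple rT * rT]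
    (fun p : n.-tuple rT * rT => [tuple of rcons p.1 p.2]).
Proof.
apply/measurable_fun_tnthP => i /=.
have [ni|] := leqP n i.
  rewrite (_ : _ \o _ = snd)//; apply/funext => -[t u] /=.
  rewrite (tnth_nth 0) /= nth_rcons size_tuple ltnNge ni /=.
  by rewrite eqn_leq ni -ltnS ltn_ord.
move=> iltn; rewrite (_ : _ \o _ = (@tnth _ _ ^~ (Ordinal iltn)) \o fst).
  by apply: measurableT_comp => //; exact: measurable_tnth.
apply/funext => -[t u] /=.
by rewrite !(tnth_nth 0) /= nth_rcons size_tuple iltn.
Qed.

(** The measure is built by adding coordinates in front, whereas marginal densities come from
    integrating out the last one. The induction peels off the first coordinate on both sides. *)
Lemma integral_lebesgue_tuple_rcons n (phi : n.+1.-tuple rT -> \bar R) :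
  measurable_fun [set: n.+1.-tuple rT] phi -> (forall t, 0 <= phi t)%E ->
  (\int[@lebesgue_tuple R n.+1]_t phi t =
   \int[@lebesgue_tuple R n]_t \int[lebesgue_measure]_u
      phi [tuple of rcons t u])%E.
Proof.
elim: n phi => [|n IHn] phi mphi phi0.
  rewrite [LHS](integral_lebesgue_tupleS_exchange mphi phi0).
  apply: eq_integral => t _; apply: eq_integral => u _; congr phi.
  by apply/val_inj => /=; rewrite (size0nil (size_tuple t)).
rewrite [LHS](integral_lebesgue_tupleS mphi phi0).
rewrite [RHS]integral_lebesgue_tupleS; last 2 first.
- apply: (measurable_fun_fubini_tonelli_F
    (fun p : n.+1.-tuple rT * rT => phi [tuple of rcons p.1 p.2])) => //.
  by apply: measurableT_comp => //; exact: measurable_rcons_pair.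
- by move=> t; exact: integral_ge0.
apply: eq_integral => x _; rewrite IHn.
- apply: eq_integral => t _; apply: eq_integral => u _; congr phi.
  exact/val_inj.
- apply: (measurableT_comp mphi).
  by apply: measurable_cons => //; exact: measurable_cst.
- by move=> t; exact: phi0.
Qed.

Lemma measurable_tuple_eq n (i j : 'I_n) :
  measurable [set t : n.-tuple rT | tnth t i = tnth t j].
Proof.
rewrite (_ : [set _ | _] =
    (fun t : n.-tuple rT => (tnth t i : R) - (tnth t j : R)) @^-1` [set 0]).
  rewrite -[X in measurable X]setTI.
  apply: measurable_funB => //; exact: measurable_tnth.
apply/seteqP; split => t /=; first by move=> ->; rewrite subrr.
by move/eqP; rewrite subr_eq0 => /eqP.
Qed.

Lemma measurable_uniq n : measurable [set t : n.-tuple rT | uniq t].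
Proof.
rewrite (_ : [set _ | _] = \bigcap_(i in [set: 'I_n])
    \bigcap_(j in [set j : 'I_n | j != i]) ~` [set t | tnth t i = tnth t j]).
  apply: fin_bigcap_measurable => // i _.
  apply: fin_bigcap_measurable => // j _.
  by apply: measurableC; exact: measurable_tuple_eq.
apply/seteqP; split => t /=.
  move=> /tuple_uniqP ti i _ j /= /eqP ji /ti ij; exact: ji.
move=> tu; apply/tuple_uniqP => i j ij; apply/eqP; apply: contrapT => /negP ji.
by apply: (tu i _ j) => //=; rewrite eq_sym.
Qed.

(** Tails that already contain a tie are null by induction. For a tail without ties, the first
    coordinate must hit one of finitely many values, which is a null event on the line. *)
Lemma lebesgue_tuple_not_uniq n :
  @lebesgue_tuple R n (~` [set t : n.-tuple rT | uniq t]) = 0%E.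
Proof.
elim: n => [|n IHn].
  rewrite (_ : ~` _ = set0) ?measure0//.
  by apply/seteqP; split => // t /=; rewrite [t]tuple0.
have mN k : measurable (~` [set t : k.-tuple rT | uniq t]).
  by apply: measurableC; exact: measurable_uniq.
pose N k := ~` [set t : k.-tuple rT | uniq t].
have mphi : measurable_fun [set: n.+1.-tuple rT]
    (fun t => (\1_(N n.+1) t : R)%:E).
  by apply/measurable_EFinP; apply: measurable_indic; exact: mN.
have phi0 t : (0 <= (\1_(N n.+1) t : R)%:E)%E by rewrite lee_fin.
have mcons : measurable_fun [set: rT * n.-tuple rT]
    (fun p : rT * n.-tuple rT => (\1_(N n.+1) [tuple of p.1 :: p.2] : R)%:E).
  by apply: (measurableT_comp mphi); exact: measurable_cons_pair.
rewrite -[X in lebesgue_tuple X]setIT -integral_indic//.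
rewrite (integral_lebesgue_tupleS_exchange mphi phi0).
rewrite (@ge0_negligible_integral _ _ _ _ setT (N n))//.
- apply: integral0_eq => t [_ /contrapT tu] /=.
  transitivity (\int[lebesgue_measure]_x
      (\1_[set x : rT | x \in t] x : R)%:E)%E.
    apply: eq_integral => x _; congr EFin; rewrite !indicE; congr (_%:R).
    congr nat_of_bool; apply/idP/idP; rewrite !inE /N /= tu andbT.
      by move=> /negP; rewrite negbK.
    by move=> xt; apply/negP; rewrite negbK.
  have ct : countable [set x : rT | x \in t].
    exact/finite_set_countable/finite_seq.
  rewrite integral_indic ?setIT; first exact: countable_lebesgue_measure0.
    exact: measurableT.
  by apply: countable_measurable => // x; exact: measurable_set1.
- exact: mN.
- apply: (measurable_fun_fubini_tonelli_G
    (fun p : rT * n.-tuple rT => (\1_(N n.+1) [tuple of p.1 :: p.2])%:E)) => //.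
- by move=> t _; apply: integral_ge0 => x _; rewrite lee_fin.
- exact: mN.
Qed.

End lebesgue_tuple_measure.

(** * Tails of a distribution with a density *)

Section tail_integral.
Context (R : realType) (disp : measure_display) (T : measurableType disp)
  (P : probability T R) (X : {RV P >-> R}) (F f : R -> R).
Hypothesis cdfF : forall x, cdf X x = (F x)%:E.
Hypothesis densf : is_density lebesgue_measure (distribution P X) f.

Lemma cdf_le1_fine x : F x <= 1.
Proof. by rewrite -lee_fin -cdfF; exact: cdf_le1. Qed.

Lemma cdf_nondecreasing_fine : {homo F : x y / x <= y}.
Proof.
by move=> x y xy; rewrite -lee_fin -!cdfF; exact: cdf_nondecreasing.
Qed.

Lemma measurable_cdf_fine : measurable_fun setT F.
Proof.
apply/measurable_EFinP; rewrite (_ : _ \o _ = cdf X).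
  exact: cdf_measurable.
by apply/funext => x; rewrite cdfF.
Qed.

Lemma integral_density_ray z :
  (\int[lebesgue_measure]_(u in `]z, +oo[) (f u)%:E = (1 - F z)%:E)%E.
Proof.
have [mf f0 fE] := densf.
by rewrite -fE// EFinB -cdfF; exact: ccdf_1_cdf.
Qed.

Lemma integral_density_itv z v : z <= v ->
  (\int[lebesgue_measure]_(u in `]z, v[) (f u)%:E = (F v - F z)%:E)%E.
Proof.
have [mf f0 fE] := densf => zv.
have mf' D : measurable_fun D (EFin \o f).
  by apply/measurable_EFinP; exact: measurable_funTS.
(* Closing the interval at [v] changes nothing for Lebesgue measure and makes []z, v]] and []v,
   +oo[] a partition of the ray. *)
rewrite (integral_itv_bndo_bndc (f := EFin \o f))//.
have : (\int[lebesgue_measure]_(u in `]z, +oo[) (f u)%:E =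
    \int[lebesgue_measure]_(u in `]z, v]) (f u)%:E +
    \int[lebesgue_measure]_(u in `]v, +oo[) (f u)%:E)%E.
  rewrite -ge0_integral_setU//=; first last.
  - apply/disj_setPS => x [] /=.
    by rewrite !in_itv/= => /andP[_ xv]; rewrite andbT ltNge xv.
  - by move=> x _; rewrite lee_fin.
  - exact: mf'.
  by rewrite -(@itv_bndbnd_setU _ _ _ (BRight v)).
rewrite !integral_density_ray => /(congr1 (fun x => x - (1 - F v)%:E)%E).
rewrite addeK// => <-.
by rewrite -EFinB; congr EFin; rewrite opprB addrC addrA subrK.
Qed.

Let S x := 1 - F x.

Let S_ge0 x : 0 <= S x. Proof. by rewrite subr_ge0 cdf_le1_fine. Qed.

(* With J_m(z) the integral, the induction hypothesis turns S(u)^(m+1) into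
   (m+1) J_m(u); exchanging the integrals over z < u < v then yields
   J_(m+1)(z) + (m+1) J_(m+1)(z) = (m+1) S(z) J_m(z). *)
Lemma tail_integral m z :
  (\int[lebesgue_measure]_(u in `]z, +oo[) (S u ^+ m * f u)%:E =
   (S z ^+ m.+1 / m.+1%:R)%:E)%E.
Proof.
have [mf f0 fE] := densf.
have mF := measurable_cdf_fine.
have mS : measurable_fun setT S by exact: measurable_funB.
elim: m z => [|m IHm] z.
  rewrite expr1 divr1 -integral_density_ray.
  by apply: eq_integral => u _; rewrite expr0 mul1r.
(* For smooth [F], [w] is minus the derivative of [S ^+ m.+1]. Without smoothness, [int_w] recovers
   [S y ^+ m.+1] as an integral of [w] by the induction hypothesis. *)
pose w v := m.+1%:R * (S v ^+ m * f v).
have w_ge0 v : 0 <= w v by rewrite mulr_ge0// mulr_ge0// exprn_ge0.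
have mw : measurable_fun setT w.
  apply: measurable_funM => //; apply: measurable_funM => //.
  exact: measurable_funX.
have int_w y : (\int[lebesgue_measure]_(v in `]y, +oo[) (w v)%:E =
    (S y ^+ m.+1)%:E)%E.
  under eq_integral do rewrite EFinM.
  rewrite ge0_integralZl_EFin//; first last.
  - apply/measurable_EFinP/measurable_funTS; apply: measurable_funM => //.
    exact: measurable_funX.
  - by move=> v _; rewrite lee_fin mulr_ge0// exprn_ge0.
  by rewrite IHm -EFinM mulrC divfK// pnatr_eq0.
pose D := [set p : R * R | z < p.1 < p.2].
have mD : measurable (D : set (measurableTypeR R * measurableTypeR R)).
  rewrite -[X in measurable X]setTI.
  apply: (@measurable_and _ (measurableTypeR R * measurableTypeR R)%type setT
    (fun p => z < p.1) (fun p => p.1 < p.2)) => //; exact: measurable_fun_ltr.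
pose g (p : measurableTypeR R * measurableTypeR R) : \bar R :=
  (\1_D p * (w p.2 * f p.1))%:E.
have g_ge0 p : (0 <= g p)%E by rewrite lee_fin mulr_ge0// mulr_ge0.
have mg : measurable_fun setT g.
  apply/measurable_EFinP; apply: measurable_funM.
    exact: measurable_indic.
  apply: measurable_funM; exact: measurableT_comp.
have J1 : (\int[lebesgue_measure]_(u in `]z, +oo[) (S u ^+ m.+1 * f u)%:E =
    \int[lebesgue_measure]_u \int[lebesgue_measure]_v g (u, v))%E.
  rewrite integral_mkcond; apply: eq_integral => u _; rewrite patchE.
  rewrite mem_setE in_itv/= andbT; have [zu|uz] := ltP z u; last first.
    rewrite integral0_eq// => v _; rewrite /g indicE memNset ?mul0r//=.
    by rewrite /D /= ltNge uz.
  rewrite EFinM -int_w -ge0_integralZr//.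
  - rewrite integral_mkcond; apply: eq_integral => v _.
    rewrite patchE /g indicE.
    have -> : ((u, v) \in D) = (u < v).
      by apply/idP/idP; rewrite inE /D /= zu.
    by rewrite mem_setE in_itv/= andbT; case: ltP; rewrite ?mul1r ?mul0r.
  - by apply/measurable_EFinP; exact: measurable_funTS.
  - by move=> v _; rewrite lee_fin.
  - by rewrite lee_fin.
(* Integrating [u] first leaves the mass of []z, v[], which is [F v - F z = S z - S v]. *)
have J2 : (\int[lebesgue_measure]_v \int[lebesgue_measure]_u g (u, v) =
    \int[lebesgue_measure]_(v in `]z, +oo[) (w v * (S z - S v))%:E)%E.
  rewrite [RHS]integral_mkcond; apply: eq_integral => v _; rewrite patchE.
  rewrite mem_setE in_itv/= andbT; have [zv|vz] := ltP z v; last first.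
    rewrite integral0_eq// => u _; rewrite /g indicE memNset ?mul0r//=.
    by rewrite /D /= => /andP[zu /(lt_trans zu)]; rewrite ltNge vz.
  have -> : S z - S v = F v - F z by rewrite /S opprB addrC addrA subrK.
  rewrite EFinM -(integral_density_itv (ltW zv)) -ge0_integralZl//.
  - rewrite [RHS]integral_mkcond; apply: eq_integral => u _.
    have DE : ((u, v) \in D) = (z < u < v) by apply/idP/idP; rewrite inE.
    rewrite patchE /g indicE DE mem_setE in_itv/=.
    by case: ifP; rewrite ?mul1r ?mul0r.
  - by apply/measurable_EFinP; exact: measurable_funTS.
  - by move=> u _; rewrite lee_fin.
  - by rewrite lee_fin.
set J := LHS.
have J_ge0 : (0 <= J)%E.
  by apply: integral_ge0 => u _; rewrite lee_fin mulr_ge0// exprn_ge0.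
have S_le y v : v \in `]y, +oo[ -> 0 <= S y - S v.
  rewrite in_itv/= andbT => /ltW yv.
  by rewrite /S opprB addrC addrA subrK subr_ge0 cdf_nondecreasing_fine.
(* Finiteness of [J] has not been established, so the relation is kept additive: the terms in [S v]
   cancel inside the integrand, and [J] is later isolated by multiplying by the inverse of
   [m.+2]. *)
have JD : (J + m.+1%:R%:E * J = (S z ^+ m.+2)%:E)%E.
  have {1}-> : J = (\int[lebesgue_measure]_(v in `]z, +oo[)
      (w v * (S z - S v))%:E)%E by rewrite /J J1 (fubini_tonelli _ mg g_ge0).
  rewrite /J -ge0_integralZl//; first last.
  - by move=> u _; rewrite lee_fin mulr_ge0// exprn_ge0.
  - apply/measurable_EFinP/measurable_funTS; apply: measurable_funM => //.
    exact: measurable_funX.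
  rewrite -ge0_integralD//; first last.
  - apply: measurable_funeM; apply/measurable_EFinP/measurable_funTS.
    by apply: measurable_funM => //; exact: measurable_funX.
  - by move=> v _; rewrite -EFinM lee_fin !mulr_ge0// exprn_ge0.
  - apply/measurable_EFinP/measurable_funTS; apply: measurable_funM => //.
    exact: measurable_funB.
  - by move=> v zv; rewrite lee_fin mulr_ge0// S_le.
  transitivity (\int[lebesgue_measure]_(v in `]z, +oo[)
      ((S z)%:E * (w v)%:E))%E.
    apply: eq_integral => v _; rewrite -!EFinM -EFinD; congr EFin.
    by rewrite /w exprS; ring.
  rewrite ge0_integralZl//; first last.
  - by rewrite lee_fin.
  - by move=> v _; rewrite lee_fin.
  - by apply/measurable_EFinP/measurable_funTS.
  by rewrite int_w -EFinM -exprS.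
have m2 : (m.+2%:R : R) != 0 by rewrite pnatr_eq0.
rewrite mulrC EFinM -JD -[X in (X + _)%E]mul1e -ge0_muleDl// -EFinD.
by rewrite addrC natr1 muleA -EFinM mulVf ?mul1e.
Qed.

End tail_integral.

(** * Law of a vector of independent variables *)

(** Supplies a bundled measure to which the law of a random vector can be compared by
    [measure_unique]. *)
Lemma ex_measure_with_density d (T : measurableType d) (R : realType)
    (mu : {measure set T -> \bar R}) (f : T -> \bar R) :
  measurable_fun [set: T] f -> (forall x, 0 <= f x)%E ->
  exists m : {measure set T -> \bar R},
    forall A, m A = (\int[mu]_(x in A) f x)%E.
Proof.
move=> mf f0; pose m A := (\int[mu]_(x in A) f x)%E.
have m0 : m set0 = 0%E by exact: integral_set0.
have m_ge0 A : (0 <= m A)%E by exact: integral_ge0.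
have m_sadd : semi_sigma_additive m.
  move=> F mF tF mUF; rewrite /m ge0_integral_bigcup//; last first.
    exact: measurable_funTS.
  by apply: is_cvg_nneseries => n _ _; exact: integral_ge0.
pose mM := isMeasure.Build _ _ _ m m0 m_ge0 m_sadd.
by exists (HB.pack_for {measure set T -> \bar R} m mM).
Qed.

Section tuple_law.
Context (R : realType).
Local Notation rT := (measurableTypeR R).

Lemma measurable_prod_tnth n (h : 'I_n -> R -> R) :
  (forall i, measurable_fun setT (h i)) ->
  measurable_fun [set: n.-tuple rT]
    (fun t : n.-tuple rT => \prod_(i < n) h i (tnth t i)).
Proof.
move=> mh; apply: measurable_prod => i _.
by apply: (measurableT_comp (mh i)); exact: measurable_tnth.
Qed.

(** Tonelli, one coordinate at a time. The factor depends on the index because it will carry the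
    indicator of one side of a box. *)
Lemma integral_lebesgue_tuple_prod n (h : 'I_n -> R -> R) :
  (forall i, measurable_fun setT (h i)) -> (forall i x, 0 <= h i x) ->
  (\int[@lebesgue_tuple R n]_t (\prod_(i < n) h i (tnth t i))%:E =
   \prod_(i < n) \int[lebesgue_measure]_x (h i x)%:E)%E.
Proof.
elim: n h => [|n IHn] h mh h0.
  rewrite integral_lebesgue_tuple0 ?big_ord0//.
  by apply/measurable_EFinP; exact: measurable_prod_tnth.
rewrite integral_lebesgue_tupleS; first last.
- by move=> t; rewrite lee_fin prodr_ge0.
- by apply/measurable_EFinP; exact: measurable_prod_tnth.
have mh' : measurable_fun [set: n.-tuple rT]
    (fun t : n.-tuple rT => \prod_(i < n) h (lift ord0 i) (tnth t i)).
  exact: (measurable_prod_tnth (fun i => mh (lift ord0 i))).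
rewrite big_ord_recl -(IHn (fun i => h (lift ord0 i)))//.
rewrite -ge0_integralZr//; first last.
- by apply: integral_ge0 => t _; rewrite lee_fin prodr_ge0.
- by move=> x _; rewrite lee_fin.
- by apply/measurable_EFinP; exact: mh.
apply: eq_integral => x _; rewrite -ge0_integralZl//; first last.
- by rewrite lee_fin.
- by move=> t _; rewrite lee_fin prodr_ge0.
- by apply/measurable_EFinP; exact: mh'.
apply: eq_integral => t _; rewrite -EFinM big_ord_recl; congr EFin.
by congr (_ * _); apply: eq_bigr => i _; rewrite tnthS.
Qed.

Definition box n (A : 'I_n -> set R) : set (n.-tuple rT) :=
  \bigcap_(i in [set: 'I_n]) (@tnth n rT ^~ i) @^-1` A i.

(** The coordinate cylinders that generate the sigma-algebra are boxes with all other sides full.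
    Boxes, in addition, are stable under intersection, as the uniqueness theorem for measures
    requires. *)
Lemma measurable_tuple_box n :
  (@measurable _ (n.-tuple rT)) =
  <<s [set B | exists A : 'I_n -> set R,
      (forall i, measurable (A i)) /\ B = box A] >>.
Proof.
apply/seteqP; split.
  apply: smallest_sub; first exact: smallest_sigma_algebra.
  move=> B; rewrite -bigcup_seq => -[i _ [C mC <-]].
  apply: sub_sigma_algebra; exists (fun j => if j == i then C else setT).
  split; first by move=> j; case: ifP.
  rewrite setTI; apply/seteqP; split => t /=.
    by move=> Ct j _ /=; case: eqVneq => [->|].
  by move=> /(_ i I) /=; rewrite eqxx.
apply: smallest_sub; first exact: sigma_algebra_measurable.
move=> _ [A [mA ->]]; apply: fin_bigcap_measurable => // i _.
rewrite -[X in measurable X]setTI; by apply: measurable_tnth => //; exact: mA.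
Qed.

(** On a box, independence and Tonelli both give the product of the one-dimensional probabilities;
    agreement on boxes extends to all measurable sets. *)
Lemma tuple_density (disp : measure_display) (T : measurableType disp)
    (P : probability T R) n (X : 'I_n -> {RV P >-> R}) (f : R -> R) :
  (forall A : 'I_n -> set R, (forall i, measurable (A i)) ->
    P (\bigcap_(i in [set: 'I_n]) X i @^-1` A i) =
    (\prod_(i < n) P (X i @^-1` A i))%E) ->
  measurable_fun setT f -> (forall x, 0 <= f x) ->
  (forall i A, measurable A ->
    P (X i @^-1` A) = \int[lebesgue_measure]_(x in A) (f x)%:E)%E ->
  is_density (@lebesgue_tuple R n)
    (pushforward P (fun t => [tuple X i t | i < n] : n.-tuple rT))
    (fun t => \prod_(i < n) f (tnth t i)).
Proof.
move=> indep mf f0 fE.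
have prod_ge0 (t : n.-tuple R) : 0 <= \prod_(i < n) f (tnth t i).
  exact: prodr_ge0.
have mprod := @measurable_prod_tnth n (fun=> f) (fun=> mf).
pose V t : n.-tuple rT := [tuple X i t | i < n].
have mV : measurable_fun setT V.
  apply/measurable_fun_tnthP => i.
  have -> : @tnth n rT ^~ i \o V = X i.
    by apply/funext => t /=; rewrite tnth_mktuple.
  exact: (measurable_funP (X i)).
split => // B mB.
have [m mE] := @ex_measure_with_density _ _ _ (@lebesgue_tuple R n)
  (fun t => (\prod_(i < n) f (tnth t i))%:E)
  (proj2 (measurable_EFinP _ _) mprod) (fun t => prod_ge0 t).
rewrite -mE.
(* The law has total mass 1, so the constant sequence [setT] is an admissible exhaustion by
   boxes. *)
apply: (measure_unique _ (fun=> setT) (@measurable_tuple_box n)) => //.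
- move=> _ _ [A [mA ->]] [C [mC ->]]; exists (fun i => A i `&` C i).
  split; first by move=> i; exact: measurableI.
  apply/seteqP; split => t.
    by move=> [At Ct] i _; split; [exact: At|exact: Ct].
  by move=> ACt; split => i _; have [] := ACt i I.
- move=> _; exists (fun=> setT); split => //.
  by apply/seteqP; split.
- by apply/seteqP; split => // t _; exists 0%N.
- move=> _ [A [mA ->]]; rewrite mE /= /pushforward.
  rewrite (_ : V @^-1` box A = \bigcap_(i in [set: 'I_n]) X i @^-1` A i).
    rewrite indep// integral_mkcond.
    transitivity (\int[@lebesgue_tuple R n]_t
        (\prod_(i < n) (f (tnth t i) * \1_(A i) (tnth t i)))%:E)%E.
      rewrite (@integral_lebesgue_tuple_prod n (fun i x => f x * \1_(A i) x)).
      - apply: eq_bigr => i _; rewrite fE// integral_mkcond.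
        apply: eq_integral => x _; rewrite patchE indicE.
        by case: ifP => _; rewrite ?mulr1 ?mulr0.
      - by move=> i; apply: measurable_funM => //; exact: measurable_indic.
      - by move=> i x; rewrite mulr_ge0.
    apply: eq_integral => t _; rewrite patchE; case: ifPn => [/set_mem tA|tA].
      congr EFin; apply: eq_bigr => i _; rewrite indicE mem_set ?mulr1//.
      exact: (tA i).
    have [i tAi] : exists i, ~ A i (tnth t i).
      apply/existsNP; apply: contraNnot tA => tA; apply/mem_set => i _.
      exact: tA.
    by rewrite (bigD1 i)//= indicE memNset// mulr0 mul0r.
  by apply/seteqP; split => t tA i _; have := tA i I; rewrite /= tnth_mktuple.
- by move=> _; rewrite /= /pushforward preimage_setT probability_setT ltry.
Qed.

End tuple_law.

(** * Law of the vector of all order statistics *)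

Lemma measurable_sorted (R : realType) n :
  measurable [set t : n.-tuple (measurableTypeR R) | sorted <=%O (t : seq R)].
Proof.
rewrite (_ : [set _ | _] = \bigcap_(i in [set: 'I_n])
    \bigcap_(j in [set j : 'I_n | (i <= j)%N])
      [set t : n.-tuple (measurableTypeR R) |
        (tnth t i : R) <= (tnth t j : R)]).
  apply: fin_bigcap_measurable => // i _.
  apply: fin_bigcap_measurable => // j _.
  rewrite -[X in measurable X]setTI.
  by apply: measurable_fun_ler => //; exact: measurable_tnth.
apply/seteqP; split => t /=.
  move=> ts i _ j /= ij; rewrite !(tnth_nth 0).
  by apply: (sorted_leq_nth le_trans le_refl) => //; rewrite inE size_tuple.
move=> ts; apply/(sortedP 0) => i; rewrite size_tuple => i1n.
have := ts (Ordinal (ltnW i1n)) I (Ordinal i1n) (leqnSn i).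
by rewrite /= !(tnth_nth 0).
Qed.

Section order_statistics_law.
Context (R : realType) (disp : measure_display) (T : measurableType disp)
  (P : probability T R) (d : nat) (X : 'I_d -> {RV P >-> R}) (f : R -> R).
Local Notation rT := (measurableTypeR R).
Hypothesis indep : mutually_independent X.
Hypothesis mf : measurable_fun setT f.
Hypothesis f0 : forall x, 0 <= f x.
Hypothesis fE : (forall i A, measurable A ->
  P (X i @^-1` A) = \int[lebesgue_measure]_(x in A) (f x)%:E)%E.

Let V (s : 'S_d) t : d.-tuple rT := [tuple X (s i) t | i < d].
Let O t : d.-tuple rT := [tuple order_stat X i t | i < d].
Let pf (t : d.-tuple rT) : R := \prod_(i < d) f (tnth t i).

Let density_permuted (s : 'S_d) :
  is_density (@lebesgue_tuple R d) (pushforward P (V s)) pf.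
Proof.
apply: (@tuple_density _ _ _ _ _ (fun i => X (s i))) => //; last first.
  by move=> i A mA; exact: fE.
move=> A mA.
(* The sides are permuted by the inverse of [s], so that the variable of index [s i] is tested
   against [A i]. *)
have := indep [set: 'I_d]%SET (fun i => mA (s^-1%g i)).
have -> : [set` [set: 'I_d]%SET] = [set: 'I_d].
  by apply/seteqP; split => // i _ /=; rewrite inE.
under eq_bigl do rewrite inE.
rewrite (reindex_inj (@perm_inj _ s))/=.
under eq_bigr do rewrite permK.
move=> <-; congr (P _); apply/seteqP; split => t tA i _.
  by have := tA (s^-1%g i) I; rewrite /= permKV.
by have := tA (s i) I; rewrite /= permK.
Qed.

Let perm_eq_permuted (s : 'S_d) t :
  perm_eq (V s t) [seq X j t | j <- enum 'I_d].
Proof.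
rewrite /= (map_comp (X^~ t) s) perm_map//.
apply: uniq_perm; rewrite ?(map_inj_uniq perm_inj) ?enum_uniq// => i.
by rewrite mem_enum -(permKV s i) mem_map ?mem_enum//; exact: perm_inj.
Qed.

Let order_stats_permuted (s : 'S_d) t : sorted <=%O (V s t) -> O t = V s t.
Proof.
move=> Vs; apply: eq_from_tnth => i; rewrite tnth_mktuple /order_stat.
set u := sort _ _; suff -> : u = V s t by rewrite (tnth_nth 0).
apply: (sorted_eq le_trans le_anti (sort_le_sorted _) Vs).
by rewrite perm_sort perm_sym perm_eq_permuted.
Qed.

Let ex_sorting_perm t : exists s : 'S_d, sorted <=%O (V s t).
Proof.
have /tuple_permP[s sE] :
    perm_eq (sort <=%O [tuple X i t | i < d]) [tuple X i t | i < d].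
  by rewrite perm_sort.
exists s; rewrite (_ : tval (V s t) = sort <=%O [tuple X i t | i < d]).
  exact: sort_le_sorted.
rewrite sE; congr tval; apply: eq_from_tnth => i.
by rewrite !tnth_mktuple.
Qed.

Let uniqV (s : 'S_d) t : uniq (V s t) = uniq (V 1%g t).
Proof. by rewrite !(perm_uniq (perm_eq_permuted _ _)). Qed.

(** Without ties a value determines its index, so only one permutation sorts the sample. This makes
    the events indexed by permutations disjoint. *)
Let perm_sorted_inj (s u : 'S_d) t : uniq (V 1%g t) ->
  sorted <=%O (V s t) -> sorted <=%O (V u t) -> s = u.
Proof.
move=> /tuple_uniqP inj /order_stats_permuted + /order_stats_permuted.
move=> -> /(congr1 (fun v : d.-tuple rT => tnth v _)) su.
apply/permP => i; apply: inj; move: (su i).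
by rewrite !tnth_mktuple !perm1.
Qed.

Let O_measurable : measurable_fun setT O.
Proof.
apply/measurable_fun_tnthP => i.
have -> : @tnth d rT ^~ i \o O = order_stat X i.
  by apply/funext => t; rewrite /= tnth_mktuple.
exact: measurable_order_stat.
Qed.

Let U := [set x : d.-tuple rT | uniq x].
Let S := [set x : d.-tuple rT | sorted <=%O (x : seq R)].

Let density_permutedE (s : 'S_d) A : measurable A ->
  (P (V s @^-1` A) = \int[@lebesgue_tuple R d]_(x in A) (pf x)%:E)%E.
Proof. by move=> mA; have [_ _ <-] := density_permuted s. Qed.

Let mpf : measurable_fun [set: d.-tuple rT] (EFin \o pf).
Proof. by apply/measurable_EFinP; have [] := density_permuted 1%g. Qed.

Let pf_ge0 x : (0 <= (pf x)%:E)%E.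
Proof. by rewrite lee_fin prodr_ge0. Qed.

Let mU : measurable U. Proof. exact: measurable_uniq. Qed.

Let P_ties : P (V 1%g @^-1` ~` U) = 0%E.
Proof.
rewrite density_permutedE; last exact: measurableC.
apply: null_set_integral; first exact: measurableC.
  exact: measurable_funTS.
exact: lebesgue_tuple_not_uniq.
Qed.

Let measurable_V (s : 'S_d) : measurable_fun setT (V s).
Proof.
apply/measurable_fun_tnthP => i.
have -> : @tnth d rT ^~ i \o V s = X (s i).
  by apply/funext => t; rewrite /= tnth_mktuple.
exact: (measurable_funP (X (s i))).
Qed.

Lemma order_stats_distribution (A : set (d.-tuple rT)) : measurable A ->
  (P (O @^-1` A) = \int[@lebesgue_tuple R d]_(x in A)
    (if sorted <=%O (x : seq R) then d`!%:R * \prod_(i < d) f (tnth x i)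
     else 0)%:E)%E.
Proof.
move=> mA.
have mS : measurable S := @measurable_sorted R d.
have mAS : measurable (A `&` S) by exact: measurableI.
have mASU : measurable (A `&` S `&` U) by exact: measurableI.
have mOA : measurable (O @^-1` A).
  by rewrite -[X in measurable X]setTI; exact: O_measurable.
have mVU : measurable (V 1%g @^-1` ~` U).
  rewrite -[X in measurable X]setTI; apply: measurable_V => //.
  exact: measurableC.
rewrite (measureDI P mOA mVU).
rewrite [X in (_ + X)%E](_ : _ = 0%E) ?adde0; last first.
  by apply: (subset_measure0 _ _ _ P_ties) => //; exact: measurableI.
(* The event with ties has been dropped as null. What remains is split according to the permutation
   that sorts the sample. *)
transitivity (P (\bigcup_(s in [set` enum {perm 'I_d}])
    (V s @^-1` (A `&` S `&` U)))).
  apply: (congr1 P); apply/seteqP; split => t /=.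
    move=> [At /contrapT ut]; have [s st] := ex_sorting_perm t.
    exists s; first by rewrite /= mem_enum.
    have Os := order_stats_permuted st.
    split; first by split => //=; rewrite -Os.
    by rewrite /U /= uniqV.
  move=> [s _ [[At st] ut]]; split; first by rewrite (order_stats_permuted st).
  by move=> nu; apply: nu; rewrite /U /= -(uniqV s).
rewrite measure_fin_bigcup; first last.
- move=> s _; rewrite -[X in measurable X]setTI; exact: measurable_V.
- move=> s u _ _ [t [[[_ st] ut] [[_ ut'] _]]].
  by apply: (@perm_sorted_inj _ _ t) => //; rewrite -(uniqV s).
- exact: finite_seq.
rewrite -fsbig_seq ?enum_uniq//.
(* All permuted vectors have density [pf], so the [d!] terms are equal; the restriction to [U]
   disappears because its complement is null. The factor [1%:E] prepares for summing by
   distributivity. *)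
rewrite (eq_bigr (fun=> 1%:E * \int[@lebesgue_tuple R d]_(x in A `&` S)
  (pf x)%:E)%E); last first.
  move=> s _; rewrite mul1e [LHS]density_permutedE//.
  rewrite [RHS](@ge0_negligible_integral _ _ _ _ _ (~` U))//.
  - by rewrite setDE setCK.
  - exact: measurableC.
  - exact: measurable_funTS.
  - exact: lebesgue_tuple_not_uniq.
rewrite big_enum/= -ge0_sume_distrl// sumEFin sumr_const.
have -> : #|{perm 'I_d}| = d`! by rewrite -card_Sn; apply: eq_card => s.
rewrite -ge0_integralZl//; last exact: measurable_funTS.
rewrite integral_mkcond [RHS]integral_mkcond; apply: eq_integral => x _.
rewrite !patchE in_setI; case: (x \in A) => //=.
have -> : (x \in S) = sorted <=%O (x : seq R).
  by apply/idP/idP; rewrite inE.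
by case: ifP.
Qed.

End order_statistics_law.

(** * Marginal densities *)

Lemma order_stat_density_ge0 (R : realType) (F f : R -> R) n k
    (x : k.-tuple R) :
  (forall u, F u <= 1) -> (forall u, 0 <= f u) ->
  0 <= order_stat_density F f n x.
Proof.
move=> F1 f0; rewrite /order_stat_density; case: ifP => // _.
rewrite !mulr_ge0 ?prodr_ge0 ?invr_ge0//.
by rewrite exprn_ge0// subr_ge0.
Qed.

Lemma measurable_order_stat_density (R : realType) (F f : R -> R) n k :
  measurable_fun setT F -> measurable_fun setT f ->
  measurable_fun [set: k.+1.-tuple (measurableTypeR R)]
    (fun x : k.+1.-tuple (measurableTypeR R) =>
      order_stat_density F f n (x : k.+1.-tuple R)).
Proof.
move=> mF mf; apply: measurable_fun_ifT => //=.
- apply: (measurable_fun_bool true).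
  by rewrite setTI; exact: measurable_sorted.
- apply: measurable_funM; last exact: (measurable_prod_tnth (fun=> mf)).
  apply: measurable_funM => //.
  apply: measurable_funX; apply: measurable_funB => //.
  apply: (measurableT_comp mF).
  rewrite (_ : (fun x : k.+1.-tuple R => last 0 x) = (@tnth _ _ ^~ ord_max)).
    exact: measurable_tnth.
  apply/funext => x; rewrite (tnth_nth 0) -nth_last size_tuple//.
Qed.

(** Positivity of [k] matters: for empty [x] the default value 0 of [last] would impose the spurious
    constraint [0 <= u]. *)
Lemma order_stat_density_rcons (R : realType) (F f : R -> R) n k
    (x : k.-tuple R) (u : R) : (0 < k)%N ->
  order_stat_density F f n [tuple of rcons x u] =
  if sorted <=%O x && (last 0 x <= u) then
    n`!%:R / (n - k.+1)`!%:R * (1 - F u) ^+ (n - k.+1) *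
    (\prod_(j < k) f (tnth x j) * f u)
  else 0.
Proof.
move=> k0; rewrite /order_stat_density /= last_rcons.
have -> : sorted <=%O (rcons x u) = sorted <=%O x && (last 0 x <= u).
  case: x => -[|a s] /= sk; last by rewrite rcons_path.
  by rewrite -(eqP sk) in k0.
case: ifP => // _; congr (_ * _); rewrite big_ord_recr/=; congr (_ * f _).
  apply: eq_bigr => i _; congr f.
  by rewrite !(tnth_nth 0)/= nth_rcons size_tuple ltn_ord.
by rewrite (tnth_nth 0)/= nth_rcons size_tuple ltnn eqxx.
Qed.

(** * Integrating the joint density over its last coordinate *)

Section tail.
Context (R : realType) (F f : R -> R).
Hypothesis F1 : forall u, F u <= 1.
Hypothesis mF : measurable_fun setT F.
Hypothesis mf : measurable_fun setT f.
Hypothesis f0 : forall u, 0 <= f u.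
Hypothesis tailF : forall m z,
  (\int[lebesgue_measure]_(u in `]z, +oo[) ((1 - F u) ^+ m * f u)%:E =
   ((1 - F z) ^+ m.+1 / m.+1%:R)%:E)%E.
Variables (n k : nat).
Hypothesis k0 : (0 < k)%N.
Hypothesis kn : (k < n)%N.

(** Beyond [last 0 x] the extended tuple stays sorted, so [tailF] applies, and its denominator turns
    [(n - k.+1)!] into [(n - k)!]. Taking [z] to be [last 0 x] gives the marginal density; a larger
    [z] gives the conditional tail. *)
Lemma integral_order_stat_density_ray (x : k.-tuple R) z :
  sorted <=%O x -> last 0 x <= z ->
  (\int[lebesgue_measure]_(u in `]z, +oo[)
     (order_stat_density F f n [tuple of rcons x u])%:E =
   (n`!%:R / (n - k)`!%:R * (1 - F z) ^+ (n - k) *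
    \prod_(j < k) f (tnth x j))%:E)%E.
Proof.
move=> sx xz; have nk : (n - k = (n - k.+1).+1)%N by rewrite subnSK.
rewrite nk; set m := (n - k.+1)%N.
transitivity (\int[lebesgue_measure]_(u in `]z, +oo[)
    ((n`!%:R / m`!%:R * \prod_(j < k) f (tnth x j))%:E *
     ((1 - F u) ^+ m * f u)%:E))%E.
  apply: eq_integral => u; rewrite inE/= in_itv/= andbT => zu.
  rewrite order_stat_density_rcons// sx (le_trans xz (ltW zu))/=.
  by rewrite -EFinM; congr EFin; ring.
rewrite ge0_integralZl//; first last.
- by rewrite lee_fin !mulr_ge0 ?prodr_ge0 ?invr_ge0.
- by move=> u _; rewrite lee_fin mulr_ge0// exprn_ge0// subr_ge0.
- apply/measurable_EFinP/measurable_funTS; apply: measurable_funM => //.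
  by apply: measurable_funX; exact: measurable_funB.
rewrite tailF -EFinM; congr EFin.
rewrite factS natrM; field.
by rewrite pnatr_eq0 -lt0n fact_gt0 addrC natr1 pnatr_eq0.
Qed.

Lemma measurable_order_stat_density_rcons (x : k.-tuple R) :
  measurable_fun setT
    (fun u : R => (order_stat_density F f n [tuple of rcons x u])%:E).
Proof.
apply/measurable_EFinP.
apply: (measurableT_comp (measurable_order_stat_density n mF mf)).
apply: (measurableT_comp (@measurable_rcons_pair R k) (g := fun u => (x, u))).
exact: measurable_fun_pair.
Qed.

Lemma integral_order_stat_density_rcons (x : k.-tuple R) :
  (\int[lebesgue_measure]_u (order_stat_density F f n [tuple of rcons x u])%:E =
   (order_stat_density F f n x)%:E)%E.
Proof.
have [sx|sx] := boolP (sorted <=%O x); last first.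
  have -> : order_stat_density F f n x = 0.
    by rewrite /order_stat_density (negbTE sx).
  rewrite integral0_eq// => u _.
  by rewrite order_stat_density_rcons// (negbTE sx).
have -> : order_stat_density F f n x = n`!%:R / (n - k)`!%:R *
    (1 - F (last 0 x)) ^+ (n - k) * \prod_(j < k) f (tnth x j).
  by rewrite /order_stat_density sx.
rewrite -(integral_order_stat_density_ray sx (lexx _)).
(* The integrand vanishes for [u < last 0 x] but possibly not at the endpoint, so the open ray is
   closed, at no cost in measure. *)
rewrite (integral_itv_obnd_cbnd
  (f := fun u => (order_stat_density F f n [tuple of rcons x u])%:E)).
  rewrite [RHS]integral_mkcond; apply: eq_integral => u _; rewrite patchE.
  rewrite order_stat_density_rcons// sx/= mem_setE in_itv/= andbT.
  by case: ifP.
exact: measurable_funTS (measurable_order_stat_density_rcons _).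
Qed.

End tail.

Section marginals.
Context (R : realType) (disp : measure_display) (T : measurableType disp)
  (P : probability T R) (n : nat) (X : 'I_n -> {RV P >-> R}) (F f : R -> R).
Local Notation rT := (measurableTypeR R).
Hypothesis indep : mutually_independent X.
Hypothesis F1 : forall u, F u <= 1.
Hypothesis mF : measurable_fun setT F.
Hypothesis mf : measurable_fun setT f.
Hypothesis f0 : forall u, 0 <= f u.
Hypothesis fE : (forall i A, measurable A ->
  P (X i @^-1` A) = \int[lebesgue_measure]_(x in A) (f x)%:E)%E.
Hypothesis tailF : forall m z,
  (\int[lebesgue_measure]_(u in `]z, +oo[) ((1 - F u) ^+ m * f u)%:E =
   ((1 - F z) ^+ m.+1 / m.+1%:R)%:E)%E.

Let Y (i : 'I_n) : {RV P >-> R} := order_stat X i.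

Lemma order_stats_joint_density k (kn : (k.+1 <= n)%N) :
  is_density (@lebesgue_tuple R k.+1) (pushforward P (initial_vector Y kn))
    (fun x => order_stat_density F f n (x : k.+1.-tuple R)).
Proof.
split; [exact: measurable_order_stat_density|
        by move=> x; exact: order_stat_density_ge0|].
(* Descending induction on the length: [j] counts the coordinates already integrated out, and
   [j = 0] is the law of the full vector. *)
have [j nE] : exists j, (n = j + k.+1)%N by exists (n - k.+1)%N; rewrite subnK.
elim: j k kn nE => [|j IHj] k kn nE A mA.
  rewrite add0n in nE; subst n.
  have ivE : initial_vector Y kn =
      (fun t => [tuple order_stat X i t | i < k.+1] : k.+1.-tuple rT).
    by apply/funext => t; apply: eq_from_tnth => i; rewrite !tnth_mktuple.
  rewrite /pushforward ivE (order_stats_distribution indep mf f0 fE mA).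
  apply: eq_integral => x _; rewrite /order_stat_density.
  by rewrite subnn fact0 divr1 expr0 mulr1.
have kn' : (k.+2 <= n)%N by rewrite nE addSnnS leq_addl.
pose tk (x : k.+2.-tuple rT) : k.+1.-tuple rT :=
  [tuple tnth x (widen_ord (leqnSn _) i) | i < k.+1].
have mtk : measurable_fun setT tk.
  apply/measurable_fun_tnthP => i.
  have -> : @tnth _ rT ^~ i \o tk = @tnth _ rT ^~ (widen_ord (leqnSn _) i).
    by apply/funext => x; rewrite /= tnth_mktuple.
  exact: measurable_tnth.
have mtkA : measurable (tk @^-1` A).
  by rewrite -[X in measurable X]setTI; exact: mtk.
have nE' : (n = j + k.+2)%N by rewrite nE addSnnS.
have tkE (x : k.+1.-tuple rT) u : tk [tuple of rcons x u] = x.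
  apply: eq_from_tnth => i; rewrite tnth_mktuple !(tnth_nth 0)/=.
  by rewrite nth_rcons size_tuple ltn_ord.
pose g k := fun x : k.-tuple rT =>
  (order_stat_density F f n (x : k.-tuple R))%:E.
have mg l : measurable_fun setT (@g l.+1).
  by apply/measurable_EFinP; exact: measurable_order_stat_density.
have g0 l (x : l.-tuple rT) : (0 <= g l x)%E.
  by rewrite lee_fin; exact: order_stat_density_ge0.
have -> : initial_vector Y kn = tk \o initial_vector Y kn'.
  apply/funext => t; apply: eq_from_tnth => i; rewrite /= !tnth_mktuple.
  by [].
rewrite /pushforward comp_preimage [LHS](IHj _ kn' nE' _ mtkA).
rewrite integral_mkcond integral_lebesgue_tuple_rcons; first last.
- by move=> x; apply: erestrict_ge0 => {}x _; exact: g0.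
- by apply/(measurable_restrictT _ _).1 => //; exact: measurable_funTS (mg _).
rewrite [RHS]integral_mkcond; apply: eq_integral => x _; rewrite patchE.
transitivity (\int[lebesgue_measure]_u
    (if x \in A then g _ [tuple of rcons x u] else 0))%E.
  apply: eq_integral => u _; rewrite patchE.
  have -> : ([tuple of rcons x u] \in tk @^-1` A) = (x \in A).
    by apply/idP/idP; rewrite !inE /= tkE.
  by [].
case: ifP => _; last exact: integral0.
exact: integral_order_stat_density_rcons.
Qed.

End marginals.

(** * Monotonicity *)

(** If [y <= l'], the right ratio is 1 and the left one is at most 1. Otherwise both numerators are
    powers of [S y], and only the denominator decreases. *)
Lemma survival_ratio_mono (R : realType) (S : R -> R) m (y l l' : R) :
  (forall u, 0 <= S u) -> {homo S : u v /~ u <= v} ->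
  l <= l' -> 0 < S l -> 0 < S l' ->
  S (Num.max l y) ^+ m / S l ^+ m <= S (Num.max l' y) ^+ m / S l' ^+ m.
Proof.
move=> S0 Sdecr ll' Sl Sl'; rewrite -!expr_div_n.
apply: lerXn2r; rewrite ?nnegrE ?divr_ge0 ?(ltW Sl) ?(ltW Sl')//.
have [yl'|l'y] := leP y l'.
  rewrite divff ?gt_eqF// ler_pdivrMr// mul1r.
  by apply: Sdecr; rewrite le_max lexx.
rewrite max_r ?(le_trans ll' (ltW l'y))//.
by rewrite ler_wpM2l// lef_pV2 ?posrE//; exact: Sdecr.
Qed.

Section CIS.
Context (R : realType) (F f : R -> R).
Hypothesis F1 : forall u, F u <= 1.
Hypothesis mF : measurable_fun setT F.
Hypothesis mf : measurable_fun setT f.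
Hypothesis f0 : forall u, 0 <= f u.
Hypothesis tailF : forall m z,
  (\int[lebesgue_measure]_(u in `]z, +oo[) ((1 - F u) ^+ m * f u)%:E =
   ((1 - F z) ^+ m.+1 / m.+1%:R)%:E)%E.
Variables (n k : nat).
Hypothesis k0 : (0 < k)%N.
Hypothesis kn : (k < n)%N.
Local Notation g := (order_stat_density F f n).

(** Since [k < n], the exponent [n - k] is nonzero, so a vanishing survival factor would annihilate
    the density. *)
Lemma order_stat_density_gt0 (x : k.-tuple R) : 0 < g x ->
  [/\ sorted <=%O x, 0 < 1 - F (last 0 x) & 0 < \prod_(j < k) f (tnth x j)].
Proof.
rewrite /order_stat_density; case: ifP => [sx|]; last by rewrite ltxx.
move=> gx; split => //.
  rewrite lt_neqAle subr_ge0 F1 andbT; apply: contraTneq gx => <-.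
  by rewrite expr0n subn_eq0 leqNgt kn/= mulr0 mul0r ltxx.
rewrite lt_neqAle prodr_ge0// andbT; apply: contraTneq gx => <-.
by rewrite mulr0 ltxx.
Qed.

Lemma cond_gt_order_stat (x : k.-tuple R) (y : R) : 0 < g x ->
  cond_gt (@order_stat_density R F f n) x y%:E =
  ((1 - F (Num.max (last 0 x) y)) ^+ (n - k) /
   (1 - F (last 0 x)) ^+ (n - k))%:E.
Proof.
move=> gx; have [sx Sx px] := order_stat_density_gt0 gx.
rewrite /cond_gt.
set l := last 0 x; set z := Num.max l y.
have -> : (\int[lebesgue_measure]_(u in [set u : R | (y%:E < u%:E)%E])
    (g [tuple of rcons x u])%:E =
    \int[lebesgue_measure]_(u in `]z, +oo[) (g [tuple of rcons x u])%:E)%E.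
  (* If [l <= y], the two domains coincide. If [y < l], the points of []y, l[] contribute nothing,
     because the extended tuple is not sorted there. *)
  have [ly|yl] := leP l y.
    rewrite /z max_r//; congr integral.
    by apply/seteqP; split => u /=; rewrite in_itv/= andbT lte_fin.
  rewrite /z max_l ?ltW// (integral_itv_obnd_cbnd
    (f := fun u => (g [tuple of rcons x u])%:E)); last first.
    by apply: measurable_funTS; exact: measurable_order_stat_density_rcons.
  rewrite integral_mkcond [RHS]integral_mkcond; apply: eq_integral => u _.
  have yE : (u \in [set v : R | (y%:E < v%:E)%E]) = (y < u).
    by apply/idP/idP; rewrite inE /= lte_fin.
  rewrite !patchE yE order_stat_density_rcons// sx/= mem_setE in_itv/= andbT.
  case: (leP l u) => [lu|_]; last by case: ifP.
  by rewrite (lt_le_trans yl lu).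
rewrite (integral_order_stat_density_ray F1 mF mf f0 tailF k0 kn sx);
  last by rewrite le_max lexx.
rewrite inver gt_eqF// -EFinM; congr EFin.
rewrite /order_stat_density sx -/l; field.
by rewrite expf_neq0 ?gt_eqF//= ?pnatr_eq0 ?ltr0n ?fact_gt0// andbT gt_eqF.
Qed.

End CIS.

Theorem proposition13 (R : realType) (disp : measure_display)
  (T : measurableType disp) (P : probability T R)
  (d : nat) (X : 'I_d -> {RV P >-> R}) (F f : R -> R) :
  (2 <= d)%N ->
  mutually_independent X ->
  identically_distributed X ->
  (forall (i : 'I_d) (x : R), cdf (X i) x = (F x)%:E) ->
  (forall i : 'I_d, is_density lebesgue_measure (distribution P (X i)) f) ->
  CIS (fun i => order_stat X i : {RV P >-> R}) (order_stat_density F f d).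
Proof.
move=> d2 indep _ cdfF densf.
(* All variables share [F] and [f], so their analytic properties can be read off any one index. *)
have i0 : 'I_d by exact: Ordinal (ltnW d2).
have [mf f0 _] := densf i0.
have F1 := cdf_le1_fine (cdfF i0).
have Fincr := cdf_nondecreasing_fine (cdfF i0).
have mF := measurable_cdf_fine (cdfF i0).
have tailF := tail_integral (cdfF i0) (densf i0).
split.
  case=> // k kn _; apply: order_stats_joint_density => // i A mA.
  by have [_ _ <-] := densf i.
move=> k /andP[k0 kd] y x x' gx gx' xx'.
have [sx Sx px] := order_stat_density_gt0 F1 f0 kd gx.
have [sx' Sx' px'] := order_stat_density_gt0 F1 f0 kd gx'.
case: y => [y| |].
- rewrite !cond_gt_order_stat// lee_fin.
  apply: (@survival_ratio_mono _ (fun u => 1 - F u)) => //.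
  + by move=> u; rewrite subr_ge0.
  + by move=> u v uv; rewrite lerB// Fincr.
  (* Only the last conditioning value enters the formula; the componentwise order is used at index
     [k.-1]. *)
  + have ltk : (k.-1 < k)%N by rewrite prednK.
    have := xx' (Ordinal ltk).
    by rewrite !(tnth_nth 0)/= -!nth_last !size_tuple.
(* For [y = +oo] both conditional probabilities are 0. *)
- rewrite /cond_gt.
  have -> : [set u : R | (+oo < u%:E)%E] = set0 by apply/seteqP; split.
  by rewrite !integral_set0 !mul0e.
(* For [y = -oo] the integral over the whole line returns the density of the conditioning vector, so
   both sides are 1. *)
- rewrite /cond_gt.
  have -> : [set u : R | (-oo < u%:E)%E] = setT.
    by apply/seteqP; split => // u _; exact: ltNyr.
  rewrite !integral_order_stat_density_rcons//.
  rewrite !inver !gt_eqF// -!EFinM !divff ?gt_eqF//.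
Qed.
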